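(* Let $n\ge 1$, let $m$ be the counting measure on $\mathbb Z^n$, and let $L$ be the generator on $\mathbb Z^n$ given by $L(z,z+e_i)=L(z,z-e_i)=1$ for $i\in\{1,\dots,n\}$, $L(z,z)=-2n$, and $L(z,w)=0$ otherwise. Then the relative entropy $H(\cdot|m)$ satisfies the $0$-displacement convexity property: for all probability measures $\nu_0,\nu_1$ on $\mathbb Z^n$ with finite support, the Schrödinger bridge at zero temperature $(\widehat Q_t)_{t\in[0,1]}$ from $\nu_0$ to $\nu_1$ satisfies, for all $t\in(0,1)$, $$H(\widehat Q_t|m)\le (1-t)H(\nu_0|m)+t\,H(\nu_1|m).$$ In other words, for any such $\nu_0,\nu_1$ the map $t\mapsto H(\widehat Q_t|m)$ is convex on $[0,1]$.
   Context: $(e_1,\dots,e_n)$ is the canonical basis of $\mathbb R^n$. The graph structure on $\mathbb Z^n$ has edges $(z,z\pm e_i)$; the graph distance is $d(x,y)=\sum_{i=1}^n|y_i-x_i|$, and $[x,y]=\{z: d(x,z)+d(z,y)=d(x,y)\}$ is the set of points lying on discrete geodesics from $x$ to $y$. For a finitely supported probability measure $q$, $H(q|m)=\sum_{z}q(z)\log\frac{q(z)}{m(z)}$ (with $0\log 0=0$). Schrödinger bridge at zero temperature. For $\gamma>0$ and $t\ge0$ let $P^\gamma_t=e^{\gamma tL}$ and $P_t^\gamma f(x)=\sum_y P_t^\gamma(x,y)f(y)$. Given finitely supported probability measures $\nu_0,\nu_1$, let $f^\gamma,g^\gamma\ge 0$ solve the Schrödinger system $f^\gamma(x)\,P_1^\gamma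 g^\gamma(x)=\nu_0(x)/m(x)$, $g^\gamma(y)\,P_1^\gamma f^\gamma(y)=\nu_1(y)/m(y)$ for all $x,y$, and set $\widehat\pi^\gamma(x,y)=m(x)P_1^\gamma(x,y)f^\gamma(x)g^\gamma(y)$. This is a uniquely determined coupling of $\nu_0,\nu_1$ (the minimizer of the relative entropy with respect to $m(x)P_1^\gamma(x,y)$ among all couplings of $\nu_0$ and $\nu_1$). It is known (Léonard) that, as $\gamma\to0$, $\widehat\pi^\gamma$ converges to a coupling $\widehat\pi$ of $\nu_0,\nu_1$, which is $W_1$-optimal, i.e. minimizes $\iint d\,d\pi$ among all couplings. The Schrödinger bridge at zero temperature from $\nu_0$ to $\nu_1$ is $$\widehat Q_t(z)=\sum_{x,y}Q_t^{x,y}(z)\,\widehat\pi(x,y),\qquad t\in[0,1],$$ where $$Q_t^{x,y}(z)=\mathbf 1_{[x,y]}(z)\prod_{i=1}^n\binom{|y_i-x_i|}{|z_i-x_i|}\;t^{d(x,z)}(1-t)^{d(z,y)}.$$ *)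

(* Defs.v *)
From HB Require Import structures.
From mathcomp Require Import all_boot all_order all_algebra.
From mathcomp Require Import all_classical all_reals all_analysis.
Set Implicit Arguments.
Unset Strict Implicit.
Unset Printing Implicit Defensive.
Import Order.TTheory GRing.Theory Num.Theory.
Import numFieldNormedType.Exports.
Local Open Scope classical_set_scope.
Local Open Scope ring_scope.

(* Sums [\sum_(z \in A) F z] over infinite [A] are the finite-support sums of
   fsbigop: they are used below only for summands with finite support. *)

Definition lattice (n : nat) : choiceType := 'rV[int]_n.

Definition basis_vec (n : nat) (i : 'I_n) : 'rV[int]_n := delta_mx 0 i.

Definition gdist (n : nat) (x y : lattice n) : nat :=
  (\sum_(i < n) `|y 0%R i - x 0%R i|)%N.

Definition geodesics (n : nat) (x y : lattice n) : set (lattice n) :=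
  [set z | (gdist x z + gdist z y)%N = gdist x y].

Definition counting_mass (R : realType) (n : nat) : lattice n -> R := fun=> 1.

Definition lattice_generator (R : realType) (n : nat) (z w : lattice n) : R :=
  if w == z then - (2 * n)%N%:R
  else if [exists i : 'I_n,
             (w == (z : 'rV[int]_n) + basis_vec i)
             || (w == (z : 'rV[int]_n) - basis_vec i)] then 1
  else 0.

Definition finite_proba (R : realType) (n : nat) (nu : lattice n -> R) : Prop :=
  [/\ forall z, 0 <= nu z,
      finite_set [set z | nu z != 0] &
      \sum_(z \in [set: lattice n]) nu z = 1].

(* The convention 0 log 0 = 0 holds since [0 * _ = 0]. *)
Definition rel_entropy (R : realType) (n : nat) (m q : lattice n -> R) : R :=
  \sum_(z \in [set: lattice n]) q z * ln (q z / m z).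

Fixpoint kernel_pow (R : realType) (n : nat) (L : lattice n -> lattice n -> R)
    (k : nat) (x y : lattice n) : R :=
  if k is k'.+1
  then \sum_(w \in [set: lattice n]) L x w * kernel_pow L k' w y
  else (x == y)%:R.

(* P_t^gamma(x, y), the (x, y) entry of exp (gamma t L). *)
Definition heat_kernel (R : realType) (n : nat)
    (L : lattice n -> lattice n -> R) (gamma t : R) (x y : lattice n) : R :=
  limn (series (fun k : nat => (gamma * t) ^+ k / k`!%:R * kernel_pow L k x y)).

(* Meaningful for [f >= 0], the summands being then nonnegative. *)
Definition heat_op (R : realType) (n : nat)
    (L : lattice n -> lattice n -> R) (gamma t : R) (f : lattice n -> R)
    (x : lattice n) : \bar R :=
  \esum_(y in [set: lattice n]) (heat_kernel L gamma t x y * f y)%:E.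

Definition schrodinger_system (R : realType) (n : nat) (m : lattice n -> R)
    (L : lattice n -> lattice n -> R) (gamma : R) (nu0 nu1 f g : lattice n -> R)
    : Prop :=
  [/\ forall x, 0 <= f x,
      forall y, 0 <= g y,
      forall x, ((f x)%:E * heat_op L gamma 1 g x)%E = (nu0 x / m x)%:E &
      forall y, ((g y)%:E * heat_op L gamma 1 f y)%E = (nu1 y / m y)%:E].

Definition schrodinger_plan (R : realType) (n : nat) (m : lattice n -> R)
    (L : lattice n -> lattice n -> R) (gamma : R) (nu0 nu1 : lattice n -> R)
    (pi : lattice n -> lattice n -> R) : Prop :=
  exists f g : lattice n -> R,
    schrodinger_system m L gamma nu0 nu1 f g /\
    forall x y, pi x y = m x * heat_kernel L gamma 1 x y * f x * g y.

Definition zero_temp_plan (R : realType) (n : nat) (m : lattice n -> R)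
    (L : lattice n -> lattice n -> R) (nu0 nu1 : lattice n -> R)
    (pihat : lattice n -> lattice n -> R) : Prop :=
  exists pi : R -> lattice n -> lattice n -> R,
    (forall gamma : R, 0 < gamma ->
       schrodinger_plan m L gamma nu0 nu1 (pi gamma)) /\
    (forall x y, pi gamma x y @[gamma --> 0^'+] --> pihat x y).

Definition point_bridge (R : realType) (n : nat) (x y : lattice n) (t : R)
    (z : lattice n) : R :=
  \1_(geodesics x y) z *
  (\prod_(i < n) 'C(`|y 0%R i - x 0%R i|, `|z 0%R i - x 0%R i|))%N%:R *
  t ^+ gdist x z * (1 - t) ^+ gdist z y.

Definition mixture_bridge (R : realType) (n : nat)
    (pihat : lattice n -> lattice n -> R) (t : R) (z : lattice n) : R :=
  \sum_(x \in [set: lattice n]) \sum_(y \in [set: lattice n])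
     point_bridge x y t z * pihat x y.

Definition zero_temp_bridge (R : realType) (n : nat) (m : lattice n -> R)
    (L : lattice n -> lattice n -> R) (nu0 nu1 : lattice n -> R)
    (Q : R -> lattice n -> R) : Prop :=
  exists pihat : lattice n -> lattice n -> R,
    zero_temp_plan m L nu0 nu1 pihat /\
    forall t, 0 <= t <= 1 -> forall z, Q t z = mixture_bridge pihat t z.

(* Main.v *)
Require Import Defs.
From HB Require Import structures.
From mathcomp Require Import all_boot all_order all_algebra.
From mathcomp Require Import all_classical all_reals all_analysis.
From mathcomp Require Import ring lra zify.
Set Implicit Arguments.
Unset Strict Implicit.
Unset Printing Implicit Defensive.
Import Order.TTheory GRing.Theory Num.Theory.
Import numFieldNormedType.Exports.
Local Open Scope classical_set_scope.
Local Open Scope ring_scope.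

(** The heat kernel of the simple random walk at a small time [gamma] is driven by
    shortest paths: [K(x, y)] is equivalent to [gamma ^ d(x, y) * k(x, y)] with
    [k(x, y) = prod_i 1 / |y_i - x_i|!] ([heat_kernel_scaled_cvg]). A Schrodinger
    plan has the form [K(x, y) f(x) g(y)], so that
    [pi(x, y) pi(x', y') K(x, y') K(x', y) = pi(x, y') pi(x', y) K(x, y) K(x', y')].
    Dividing by the right power of [gamma] and letting [gamma] tend to 0 shows,
    for [rho = pihat / k], that [rho(x, y) rho(x', y') = rho(x, y') rho(x', y)] if
    exchanging the endpoints preserves the total distance, and that the left-hand
    side is 0 if the exchange shortens it ([zero_temp_plan_swap]). The rest of the
    argument draws everything it knows about optimality from this swap property.

    Let [M_j(w, v)] be the mass, at time [t], of the pairs [(x, y)] having a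
    geodesic that runs from [w] to [v] in [j] steps, weighted by
    [rho(x, y) k(x, w) t ^ d(x, w) k(v, y) (1 - t) ^ d(v, y)]. Then
    [Q_t(z) = M_0(z, z)], time derivatives only add a step before [w] or after [v]
    ([deriv_transit]), and the swap property yields the Markov identity
    [M_i(w, z) M_j(z, v) = M_{i+j}(w, v) M_0(z, z)] ([transit_rank_one]).

    The second derivative of [sum_z Q_t(z) ln Q_t(z)] is the sum of
    [Q'(z)^2 / Q(z)] over [z] and of
    [K (ln Q(w+s+s') - ln Q(w+s) - ln Q(w+s') + ln Q(w))] over the points [w] and
    the pairs of steps [s, s'], where [K = M_2(w, w+s+s')]. By the Markov identity
    the logarithm is [- ln a - ln b], where [a] and [b] are products of two edge
    flows over [K Q(w+s+s')] and [K Q(w)], and [ln a <= a - 1] bounds each summand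
    below by [2 K] minus these products over [Q(w+s+s')] and [Q(w)]. On the other
    hand [Q'] is inflow minus outflow; expanding its square over pairs of steps
    gives back the same products, and the cross terms give [- 2 K] by the Markov
    identity again. Hence the second derivative is nonnegative on the open
    interval ([entropy_deriv2_ge0]). Convexity extends to the endpoints because
    [x ln x] is continuous at 0, and there the bridge has marginals [nu0] and
    [nu1]. *)

(** * Finite sums *)

Lemma fsum_seq (R : nmodType) (T : choiceType) (r : seq T) (F : T -> R) :
  uniq r -> (forall a : T, F a != 0 -> a \in r) ->
  \sum_(a \in [set: T]) F a = \sum_(a <- r) F a.
Proof.
move=> ur Fr; rewrite (fsbigE r)//.
  by rewrite [LHS]big_mkcond; apply: eq_bigr => a _; rewrite in_setT.
by move=> a _ ar; apply: contraNeq ar => /Fr.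
Qed.

(** A translation only moves the support of the summand, which lies in the window
    [V] before and after. *)
Lemma sum_shift (R : nmodType) (T : zmodType) (V : seq T) (a : T) (g : T -> R) :
  uniq V -> (forall z, g z != 0 -> z \in V) ->
  (forall z, g z != 0 -> z - a \in V) ->
  \sum_(w <- V) g (w + a) = \sum_(z <- V) g z.
Proof.
move=> uV gV gVa.
rewrite (bigID (fun z => g (z + a) != 0)) /= [X in _ + X]big1 ?addr0; last first.
  by move=> i /negbNE/eqP.
rewrite [RHS](bigID (fun z => g z != 0)) /= [X in _ = _ + X]big1 ?addr0; last first.
  by move=> i /negbNE/eqP.
rewrite -[LHS]big_filter -[RHS]big_filter -(big_map (+%R^~ a) xpredT g).
apply: perm_big; apply: uniq_perm.
- by rewrite map_inj_uniq ?filter_uniq//; exact: addIr.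
- exact: filter_uniq.
move=> z; rewrite mem_filter; apply/mapP/andP => [[w]|[gz zV]].
  by rewrite mem_filter => /andP[gw _] ->; split=> //; exact: gV.
by exists (z - a); rewrite ?subrK// mem_filter subrK gz gVa.
Qed.

(** Once expanded over [x, y, x', y'], both sides carry the same monomials
    [a x * a' x' * b y * b' y'], so only products of coefficients matter. *)
Lemma exchange_product_sums (A : comPzRingType) (I J : Type) (r : seq I) (q : seq J)
    (c1 c2 c3 c4 : I -> J -> A) (a a' : I -> A) (b b' : J -> A) :
  (forall x y x' y', c1 x y * c2 x' y' = c3 x y' * c4 x' y) ->
  (\sum_(x <- r) \sum_(y <- q) c1 x y * a x * b y) *
  (\sum_(x <- r) \sum_(y <- q) c2 x y * a' x * b' y) =
  (\sum_(x <- r) \sum_(y <- q) c3 x y * a x * b' y) *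
  (\sum_(x <- r) \sum_(y <- q) c4 x y * a' x * b y).
Proof.
move=> c1234; rewrite !big_distrlr /=.
apply: eq_bigr => x _; apply: eq_bigr => x' _.
rewrite !big_distrlr /= exchange_big /=.
apply: eq_bigr => y' _; apply: eq_bigr => y _.
transitivity (c1 x y * c2 x' y' * (a x * a' x' * b y * b' y')); first by ring.
by rewrite c1234; ring.
Qed.

(** * Geodesics of the grid *)
Section LatticeGeometry.
Variable n : nat.
Implicit Types (x y z w v : 'rV[int]_n) (s : 'I_n * bool).

Local Notation cdist x y i := (absz (y 0%R i - x 0%R i)).

Lemma gdistC x y : gdist x y = gdist y x.
Proof. by apply: eq_bigr => i _; rewrite distnC. Qed.

Lemma gdistxx x : gdist x x = 0%N.
Proof. by rewrite /gdist big1// => i _; rewrite subrr. Qed.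

Lemma gdist_triangle z x y : (gdist x y <= gdist x z + gdist z y)%N.
Proof.
rewrite /gdist -big_split leq_sum// => i _ /=.
by rewrite addnC leqD_dist.
Qed.

Lemma gdist_eq0 x y : (gdist x y == 0%N) = (x == y).
Proof.
apply/eqP/eqP => [|->]; last exact: gdistxx.
move/eqP; rewrite /gdist sum_nat_eq0 => /forallP h.
apply/rowP => i; have := h i; rewrite /= absz_eq0 subr_eq0 => /eqP ->//.
Qed.

(** The sign is indexed by a boolean so that the 2n oriented steps form a
    finite type over which the generator and the flows are summed. *)
Definition unit_step s : 'rV[int]_n := (-1) ^+ s.2 *: delta_mx 0 s.1.

Lemma unit_stepE s i : unit_step s 0 i = if i == s.1 then (-1) ^+ s.2 else 0.
Proof. by rewrite !mxE eqxx /=; case: eqP => _; rewrite ?mulr1 ?mulr0. Qed.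

Lemma unit_stepN i b : unit_step (i, ~~ b) = - unit_step (i, b).
Proof. by rewrite /unit_step /= signrN scaleNr. Qed.

Lemma gdist_step w s : gdist w (w + unit_step s) = 1%N.
Proof.
rewrite /gdist (bigD1 s.1)//= big1 => [|i /negbTE is1].
  by rewrite mxE unit_stepE eqxx addrAC subrr add0r addn0; case: s.2.
by rewrite mxE unit_stepE is1 addr0 subrr.
Qed.

Lemma gdist_steps w s s' : (gdist w (w + unit_step s + unit_step s')%R <= 2)%N.
Proof.
apply: leq_trans (gdist_triangle (w + unit_step s) _ _) _.
by rewrite !gdist_step.
Qed.

Variable R : realType.

Lemma sum_flip_step (F : 'I_n * bool -> R) :
  \sum_s F (s.1, ~~ s.2) = \sum_s F s.
Proof.
pose flip (s : 'I_n * bool) := (s.1, ~~ s.2).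
have flipK : involutive flip by move=> [i b]; rewrite /flip /= negbK.
by rewrite [RHS](reindex_inj (inv_inj flipK)).
Qed.

(** [d(x, y)! * inv_facts x y] is the multinomial number of geodesics from [x]
    to [y]; this weight is therefore the leading coefficient of the heat kernel
    at small times. *)
Definition inv_facts x y : R := \prod_i ((cdist x y i)`!%:R)^-1.

Lemma inv_factsC x y : inv_facts x y = inv_facts y x.
Proof. by apply: eq_bigr => i _; rewrite distnC. Qed.

Lemma inv_factsxx x : inv_facts x x = 1.
Proof. by rewrite /inv_facts big1// => i _; rewrite subrr fact0 invr1. Qed.

Lemma inv_facts_gt0 x y : 0 < inv_facts x y.
Proof. by rewrite prodr_gt0// => i _; rewrite invr_gt0 ltr0n fact_gt0. Qed.
Lemma gdist_step_back x w i b :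
  (((gdist x (w - unit_step (i, b))%R).+1 == gdist x w) =
   ((cdist x (w - unit_step (i, b))%R i).+1 == cdist x w i))%N.
Proof.
rewrite /gdist (bigD1 i)//= [X in _ == X](bigD1 i)//= -addSn.
rewrite [X in (_ + X)%N == _](_ : _ = \sum_(j < n | j != i) cdist x w j)%N.
  by rewrite eqn_add2r.
by apply: eq_bigr => j /negbTE ji; rewrite !mxE ji mulr0 subr0.
Qed.

Lemma inv_facts_step_back x w i b :
  ((cdist x (w - unit_step (i, b))%R i).+1 = cdist x w i)%N ->
  inv_facts x (w - unit_step (i, b))%R = (cdist x w i)%:R * inv_facts x w.
Proof.
move=> h; rewrite /inv_facts (bigD1 i)//= [in RHS](bigD1 i)//= mulrA.
congr (_ * _); last first.
  by apply: eq_bigr => j /negbTE ji; rewrite !mxE ji mulr0 subr0.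
rewrite -h factS natrM invfM mulrA mulfV ?mul1r ?pnatr_eq0//.
Qed.

(** The last step of a geodesic from [x] to [w] moves one coordinate [i] towards
    [w], in a single direction, and undoing it multiplies the weight by
    [|w_i - x_i|]; these factors add up to the distance. Both the number of
    shortest paths and the time derivative of the bridge rest on this identity. *)
Lemma gdist_inv_factsl x w :
  \sum_s ((gdist x (w - unit_step s)).+1 == gdist x w)%:R
         * inv_facts x (w - unit_step s) = (gdist x w)%:R * inv_facts x w.
Proof.
rewrite /gdist natr_sum mulr_suml.
rewrite -(pair_bigA _ (fun i b =>
   ((gdist x (w - unit_step (i, b))%R).+1 == gdist x w)%:R
         * inv_facts x (w - unit_step (i, b))%R)) /=.
apply: eq_bigr => i _; rewrite big_bool !gdist_step_back.
have h b : ((cdist x (w - unit_step (i, b))%R i).+1 == cdist x w i)%N%:R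
    * inv_facts x (w - unit_step (i, b))%R =
   ((cdist x (w - unit_step (i, b))%R i).+1 == cdist x w i)%N%:R
    * ((cdist x w i)%:R * inv_facts x w).
  by case: eqP => [/inv_facts_step_back -> //|_]; rewrite !mul0r.
rewrite !h /= -mulrDl mulrA -natrD -natrM; congr (_%:R * _).
rewrite !mxE !eqxx /= expr1 expr0 !mulr1.
have [->|d0] := eqVneq (cdist x w i) 0%N; first by rewrite muln0.
rewrite (_ : (_ + _ = 1)%N) ?mul1n//.
by move: d0; do 2 case: eqP => /=; lia.
Qed.

Lemma gdist_inv_factsr v y :
  \sum_s ((gdist (v + unit_step s) y).+1 == gdist v y)%:R
         * inv_facts (v + unit_step s) y = (gdist v y)%:R * inv_facts v y.
Proof.
rewrite gdistC inv_factsC -gdist_inv_factsl.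
rewrite -sum_flip_step; apply: eq_bigr => -[i b] _ /=.
by rewrite unit_stepN gdistC inv_factsC.
Qed.

(** The triangle inequality holds in each coordinate, so equality of the sums
    forces equality in each of them. *)
Lemma geodesic_coord x y z :
  (gdist x z + gdist z y = gdist x y)%N -> forall i,
  (cdist x z i + cdist z y i = cdist x y i)%N.
Proof.
rewrite /gdist -big_split /= => /esym/eqP h i; apply/esym/eqP; move: i.
have le i : true -> (cdist x y i <= cdist x z i + cdist z y i)%N.
  by move=> _; rewrite addnC leqD_dist.
have := leqif_sum (fun i (_ : true) => leqif_eq (le i isT)).
by move=> [_]; rewrite h => /esym/forallP.
Qed.

(** The binomial weights of the bridge are exactly what makes the past and the
    future of a midpoint separate into two factors. *)
Lemma inv_facts_binomial x y z :
  (gdist x z + gdist z y = gdist x y)%N ->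
  (\prod_(i < n) 'C(`|y 0%R i - x 0%R i|, `|z 0%R i - x 0%R i|))%N%:R
    * inv_facts x y = inv_facts x z * inv_facts z y.
Proof.
move=> /geodesic_coord h.
rewrite natr_prod -!big_split; apply: eq_bigr => i _ /=.
rewrite -(h i); set a := absz _; set b := absz _.
rewrite -(bin_fact (leq_addr b a)) addKn !natrM !invfM mulVKf //.
by rewrite pnatr_eq0 -lt0n bin_gt0 leq_addr.
Qed.
End LatticeGeometry.

(** * Powers of the generator *)
Section HeatKernel.
Variables (R : realType) (n : nat).
Implicit Types (x y z w : 'rV[int]_n) (s : 'I_n * bool).
Local Notation d := (@gdist n).
Local Notation kf := (@inv_facts n R).
Local Notation L := (@lattice_generator R n).
Local Notation Lpow := (kernel_pow L).

Lemma unit_step_neq0 s : unit_step s != 0.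
Proof. by apply/eqP => E; have := gdist_step 0 s; rewrite E addr0 gdistxx. Qed.

Lemma unit_step_inj : injective (@unit_step n).
Proof.
move=> [i b] [j b'] /rowP/(_ i); rewrite !unit_stepE /= eqxx.
by case: eqVneq => [->|_]; case: b => //; case: b'.
Qed.

Lemma kernel_powS k x y :
  Lpow k.+1 x y = - (2 * n)%N%:R * Lpow k x y + \sum_s Lpow k (x + unit_step s) y.
Proof.
pose r := x :: [seq x + unit_step s | s <- enum {: 'I_n * bool}].
have E s : L x (x + unit_step s) = 1.
  rewrite /lattice_generator -subr_eq0 addrAC subrr add0r (negbTE (unit_step_neq0 s)).
  rewrite ifT//; apply/existsP; exists s.1; case: s => i [] /=.
    by rewrite /unit_step /= expr1 scaleN1r eqxx orbT.
  by rewrite /unit_step /= expr0 scale1r eqxx.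
rewrite /= (@fsum_seq _ _ r).
- rewrite big_cons big_map big_enum /= {1}/lattice_generator eqxx.
  by congr (_ + _); apply: eq_bigr => s _; rewrite E mul1r.
- rewrite /r /= map_inj_uniq ?enum_uniq; last first.
    by move=> s s' /addrI/unit_step_inj.
  rewrite andbT; apply/mapP => -[s _ /esym/eqP].
  by rewrite -subr_eq0 addrAC subrr add0r (negbTE (unit_step_neq0 s)).
- move=> z; rewrite mulf_eq0 negb_or => /andP[+ _]; rewrite /lattice_generator inE.
  have [->//|_] := eqVneq z x.
  case: ifP => [/existsP[i /orP[]/eqP->] _|]; last by rewrite eqxx.
    apply/mapP; exists (i, false); first by rewrite mem_enum.
    by rewrite /unit_step expr0 scale1r.
  apply/mapP; exists (i, true); first by rewrite mem_enum.
  by rewrite /unit_step expr1 scaleN1r.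
Qed.

Lemma card_steps : #|{: 'I_n * bool}| = (2 * n)%N.
Proof. by rewrite card_prod card_ord card_bool mulnC. Qed.

(** The absolute values in a row of the generator add up to [4 n]. *)
Lemma kernel_pow_bound k x y : `|Lpow k x y| <= (4 * n)%N%:R ^+ k.
Proof.
elim: k x y => [|k IH] x y; first by rewrite expr0 /=; case: eqP; rewrite ?normr1 ?normr0.
rewrite kernel_powS (le_trans (ler_normD _ _))//.
rewrite exprS (_ : (4 * n = 2 * n + 2 * n)%N); last by lia.
rewrite natrD mulrDl lerD//.
  by rewrite normrM normrN normr_nat ler_wpM2l// (le_trans (IH _ _))// -natrD; 
     rewrite (_ : (4 * n = 2 * n + 2 * n)%N)//; lia.
apply: le_trans (ler_norm_sum _ _ _) _.
rewrite -card_steps mulr_natl -sumr_const ler_sum// => s _.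
rewrite (le_trans (IH _ _))// card_steps -natrD (_ : (4 * n = 2 * n + 2 * n)%N)//; lia.
Qed.

Lemma gdist_step_lb x y s : (d x y <= (d (x + unit_step s)%R y).+1)%N.
Proof.
by have := gdist_triangle (x + unit_step s) x y; rewrite gdist_step add1n.
Qed.

Lemma kernel_pow_small k x y : (k < d x y)%N -> Lpow k x y = 0.
Proof.
elim: k x y => [|k IH] x y kd.
  by rewrite /=; case: eqP kd => // ->; rewrite gdistxx.
rewrite kernel_powS IH ?(ltnW kd)// mulr0 add0r big1// => s _.
by apply: IH; have := gdist_step_lb x y s; lia.
Qed.

(** Only shortest paths reach distance [d x y] in as many steps: the diagonal
    term and the steps away from [y] vanish by [kernel_pow_small]. *)
Lemma kernel_pow_gdist x y : Lpow (d x y) x y = (d x y)`!%:R * kf x y.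
Proof.
move: {-1}(d x y) (erefl (d x y)) => k; elim: k x y => [|k IH] x y kd.
  move/eqP: kd; rewrite gdist_eq0 => /eqP ->.
  by rewrite /= eqxx fact0 mul1r inv_factsxx.
rewrite kernel_powS kernel_pow_small ?kd// mulr0 add0r factS natrM.
rewrite mulrAC -{1}kd -gdist_inv_factsr mulr_suml.
apply: eq_bigr => s _; rewrite kd eqSS.
case: eqP => [E|E]; first by rewrite IH// mul1r mulrC.
rewrite !mul0r kernel_pow_small//; have := gdist_step_lb x y s.
by rewrite kd; lia.
Qed.

(** The generator is invariant under translations and the central symmetry; the
    choice [a = x + y] exchanges [x] and [y], whence the symmetry below. *)
Lemma kernel_pow_reflect k a x y : Lpow k (a - x) (a - y) = Lpow k x y.
Proof.
elim: k x y => [|k IH] x y.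
  by rewrite /= (inj_eq (can_inj (subKr a))).
rewrite !kernel_powS IH; congr (_ + _).
rewrite -sum_flip_step; apply: eq_bigr => -[i b] _ /=.
by rewrite unit_stepN -(IH (x + unit_step (i, b))) opprD addrA.
Qed.

Lemma kernel_powC k x y : Lpow k x y = Lpow k y x.
Proof. by rewrite -(kernel_pow_reflect k (x + y) x y) addrAC subrr add0r addrK. Qed.

Lemma heat_kernelC gamma t x y : heat_kernel L gamma t x y = heat_kernel L gamma t y x.
Proof.
by rewrite /heat_kernel; under eq_fun do rewrite kernel_powC.
Qed.

End HeatKernel.

(** * The heat kernel at small times *)
Section SmallTimeAsymptotics.
Variables (R : realType) (n : nat).
Implicit Types (x y z w : 'rV[int]_n) (s : 'I_n * bool).
Local Notation d := (@gdist n).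
Local Notation kf := (@inv_facts n R).
Local Notation L := (@lattice_generator R n).
Local Notation Lpow := (kernel_pow L).

Let B : R := (4 * n)%N%:R.

(** In the exponential series the terms of index below [d x y] vanish, the one of
    index [d x y] is the announced value, and the others carry at least one more
    factor [gamma], which leaves a tail of the series of [exp (4 n)]. *)
Lemma heat_kernel_approx (gamma : R) x y : 0 < gamma <= 1 ->
  `|heat_kernel L gamma 1 x y - gamma ^+ d x y * kf x y|
    <= gamma ^+ (d x y).+1 * expR B.
Proof.
move=> /andP[g0 g1]; rewrite /heat_kernel.
set u := (fun k : nat => _).
have u_le k : `|u k| <= exp_coeff B k.
  rewrite /u /exp_coeff /= mulr1 normrM ger0_norm ?divr_ge0 ?exprn_ge0 ?(ltW g0)//.
  rewrite mulrAC ler_wpM2r ?invr_ge0// -[leRHS]mul1r ler_pM ?exprn_ge0 ?(ltW g0)//.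
    exact: exprn_ile1 (ltW g0) g1.
  exact: kernel_pow_bound.
have ud : u (d x y) = gamma ^+ d x y * kf x y.
  by rewrite /u mulr1 kernel_pow_gdist mulrA divfK// pnatr_eq0 -lt0n fact_gt0.

have tail k : `|u k - (k == d x y)%:R * (gamma ^+ d x y * kf x y)|
    <= gamma ^+ (d x y).+1 * exp_coeff B k.
  case: (ltngtP k (d x y)) => kd.
  - rewrite mul0r subr0 /u kernel_pow_small// mulr0 normr0.
    by rewrite mulr_ge0 ?exprn_ge0 ?exp_coeff_ge0 ?(ltW g0).
  - rewrite mul0r subr0 /u mulr1 /exp_coeff /= normrM.
    rewrite ger0_norm ?divr_ge0 ?exprn_ge0 ?(ltW g0)// mulrAC mulrA.
    rewrite ler_wpM2r ?invr_ge0// ler_pM ?exprn_ge0 ?(ltW g0)//.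
      by apply: ler_wiXn2l => //; exact: ltW.
    exact: kernel_pow_bound.
  - rewrite mul1r kd ud subrr normr0.
    by rewrite mulr_ge0 ?exprn_ge0 ?exp_coeff_ge0 ?(ltW g0).
have cu : cvgn (series u).
  apply: normed_cvg; apply: (series_le_cvg _ _ u_le) => // [k|].
    exact: exp_coeff_ge0.
  exact: is_cvg_series_exp_coeff.
have partial N : (d x y < N)%N -> `|series u N - gamma ^+ d x y * kf x y| <=
    gamma ^+ (d x y).+1 * expR B.
  move=> dN; have -> : series u N - gamma ^+ d x y * kf x y =
      \sum_(0 <= k < N) (u k - (k == d x y)%:R * (gamma ^+ d x y * kf x y)).
    rewrite sumrB /series /=; congr (_ - _).
    rewrite (bigD1_seq (d x y)) ?mem_index_iota ?iota_uniq//= eqxx mul1r.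
    by rewrite big1 ?addr0// => k /negbTE ->; rewrite mul0r.
  apply: le_trans (ler_norm_sum _ _ _) _.
  apply: le_trans (ler_sum _ (fun k _ => tail k)) _.
  rewrite -mulr_sumr ler_wpM2l ?exprn_ge0 ?(ltW g0)//.
  apply: (@nondecreasing_cvgn_le _ (series (exp_coeff B))).
    by apply: nondecreasing_series => k _ _; exact: exp_coeff_ge0.
  exact: is_cvg_series_exp_coeff.
have near_partial : \forall N \near \oo, `|series u N - gamma ^+ d x y * kf x y| <=
    gamma ^+ (d x y).+1 * expR B.
  near=> N; apply: partial; near: N; exact: nbhs_infty_gt.
rewrite ler_norml; apply/andP; split.
  rewrite lerBrDl; apply: limr_ge => //; apply: filterS near_partial => N.
  by rewrite ler_norml => /andP[+ _]; rewrite lerBrDl.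
rewrite lerBlDl; apply: limr_le => //; apply: filterS near_partial => N.
by rewrite ler_norml => /andP[_ +]; rewrite lerBlDl.
Unshelve. all: by end_near. Qed.

Lemma heat_kernel_scaled_cvg x y :
  heat_kernel L gamma 1 x y / gamma ^+ d x y @[gamma --> (0:R)^'+] --> kf x y.
Proof.
apply/subr_cvg0/norm_cvg0P.
apply: (@squeeze_cvgr _ _ _ _ (cst 0) (fun g => g * expR B)).
- near=> g; rewrite normr_ge0 /=.
  have g0 : 0 < g by near: g; exact: nbhs_right_gt.
  have g1 : g <= 1 by near: g; exact: nbhs_right_le.
  have gd : 0 < g ^+ d x y by rewrite exprn_gt0.
  rewrite [X in `|X|](_ : _ = (heat_kernel L g 1 x y - g ^+ d x y * kf x y) / g ^+ d x y).
    rewrite normrM normfV (gtr0_norm gd) ler_pdivrMr// mulrAC -exprS.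
    by apply: heat_kernel_approx; rewrite g0.
  by rewrite /= mulrBl mulrAC mulfV ?mul1r// gt_eqF.
- exact: cvg_cst.
- have h : (fun g : R => g * expR B) g @[g --> (0 : R)^'+] --> 0 * expR B.
    apply: cvgM; last exact: cvg_cst.
    by apply: cvg_at_right_filter; exact: cvg_id.
  by rewrite mul0r in h.
Unshelve. all: by end_near. Qed.

Lemma heat_kernel_gt0 x y :
  \forall gamma \near (0 : R)^'+, 0 < heat_kernel L gamma 1 x y.
Proof.
have h : \forall g \near (0 : R)^'+, 0 < heat_kernel L g 1 x y / g ^+ d x y.
  exact: (cvgr_gt (kf x y) (@heat_kernel_scaled_cvg x y) _ (inv_facts_gt0 R x y)).
near=> g.
have g0 : 0 < g by near: g; exact: nbhs_right_gt.
have : 0 < heat_kernel L g 1 x y / g ^+ d x y by near: g; exact: h.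
by rewrite pmulr_lgt0// invr_gt0 exprn_gt0.
Unshelve. all: by end_near. Qed.
End SmallTimeAsymptotics.

(** * The limit of the Schrodinger plans *)
Section ProductWithEsum.
Variables (R : realType) (T : choiceType) (f v : R) (F : T -> R).
Hypothesis f_ge0 : 0 <= f.
Hypothesis fFv : (f%:E * (\esum_(y in [set: T]) (F y)%:E) = v%:E)%E.

Lemma partial_sum_le (A : seq T) : uniq A -> f * \sum_(y <- A) F y <= v.
Proof.
move=> uA; rewrite -lee_fin -fFv EFinM lee_wpmul2l ?lee_fin// esum_ge//.
exists [set` A]; first by split=> //; exact: finite_seq.
by rewrite -fsbig_seq// sumEFin.
Qed.

(** The sum is a supremum over finite index sets, each of which can only lose
    from its terms outside [Y], where [F] is not positive once [f > 0]. *)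
Lemma le_partial_sum (Y : seq T) : uniq Y ->
  (forall y, y \notin Y -> f * F y <= 0) -> (forall y, y \in Y -> 0 <= F y) ->
  v <= f * \sum_(y <- Y) F y.
Proof.
move=> uY FY0 FY.
have [f0|f_gt0] := leP f 0.
  have fE : f = 0 by apply/eqP; rewrite eq_le f0.
  by move: fFv; rewrite fE mul0e mul0r => -[<-].
rewrite -lee_fin -fFv EFinM lee_wpmul2l ?lee_fin//.
apply: ge_ereal_sup => _ [A [finA _] <-].
rewrite fsbig_finite// sumEFin lee_fin.
move: (finmap.enum_fset (fset_set A)) (finmap.fset_uniq (fset_set A)) => A' uA'.
rewrite (bigID (fun y => y \in Y)) /= -[leRHS]addr0 lerD//; last first.
  by apply: sumr_le0 => y /FY0; rewrite pmulr_rle0.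
rewrite [leRHS](bigID (fun y => y \in A')) /= -[leLHS]addr0 lerD//; last first.
  by rewrite big_seq_cond sumr_ge0// => y /andP[/FY].
rewrite -[leLHS]big_filter -[leRHS]big_filter le_eqVlt; apply/orP; left.
apply/eqP; apply: perm_big; apply: uniq_perm; rewrite ?filter_uniq// => y.
by rewrite !mem_filter andbC.
Qed.
End ProductWithEsum.

Section SchrodingerPlans.
Variables (R : realType) (n : nat).
Implicit Types (x y : 'rV[int]_n) (nu : lattice n -> R).
Local Notation d := (@gdist n).
Local Notation kf := (@inv_facts n R).
Local Notation L := (@lattice_generator R n).
Local Notation K gamma := (heat_kernel L gamma 1).
Local Notation m := (@counting_mass R n).

Lemma schrodinger_planC gamma nu0 nu1 pi :
  schrodinger_plan m L gamma nu0 nu1 pi ->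
  schrodinger_plan m L gamma nu1 nu0 (fun x y => pi y x).
Proof.
move=> [f [g [[f0 g0 fg gf] piE]]]; exists g, f; split; first by split.
by move=> x y; rewrite piE heat_kernelC; rewrite /counting_mass; ring.
Qed.

Lemma zero_temp_planC nu0 nu1 pi :
  zero_temp_plan m L nu0 nu1 pi -> zero_temp_plan m L nu1 nu0 (fun x y => pi y x).
Proof.
move=> [p [hp cp]]; exists (fun gamma x y => p gamma y x); split => [gamma g0|x y].
  exact/schrodinger_planC/hp.
exact: cp.
Qed.

Lemma schrodinger_plan_le gamma nu0 nu1 pi x (A : seq (lattice n)) :
  schrodinger_plan m L gamma nu0 nu1 pi -> uniq A ->
  \sum_(y <- A) pi x y <= nu0 x.
Proof.
move=> [f [g [[f0 g0 fg gf] piE]]] uA.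
have E y : pi x y = f x * (K gamma x y * g y).
  by rewrite piE /counting_mass; ring.
under eq_bigr do rewrite E.
rewrite -mulr_sumr; have := partial_sum_le (f0 x) (fg x) uA.
by rewrite /counting_mass divr1.
Qed.

Lemma schrodinger_plan_le1 gamma nu0 nu1 pi x y :
  schrodinger_plan m L gamma nu0 nu1 pi -> pi x y <= nu0 x.
Proof.
by move=> /(@schrodinger_plan_le _ _ _ _ x [:: y])/(_ isT); rewrite big_seq1.
Qed.

Lemma schrodinger_plan_ge gamma nu0 nu1 pi x (Y : seq (lattice n)) :
  schrodinger_plan m L gamma nu0 nu1 pi -> uniq Y ->
  (forall y, y \notin Y -> nu1 y = 0) -> (forall y, y \in Y -> 0 < K gamma x y) ->
  nu0 x <= \sum_(y <- Y) pi x y.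
Proof.
move=> pP uY Y0 K0; have piC := schrodinger_planC pP.
case: pP => [f [g [[f0 g0 fg gf] piE]]].
have E y : f x * (K gamma x y * g y) = pi x y.
  by rewrite piE /counting_mass; ring.
have := le_partial_sum (f0 x) (fg x) uY.
rewrite /counting_mass divr1 mulr_sumr; under eq_bigr do rewrite E.
apply => y yY; last by rewrite mulr_ge0// ltW// K0.
by rewrite E -(Y0 y yY) (schrodinger_plan_le1 y x piC).
Qed.

Lemma schrodinger_plan_ge0 gamma nu0 nu1 pi x y :
  schrodinger_plan m L gamma nu0 nu1 pi -> 0 < K gamma x y -> 0 <= pi x y.
Proof.
move=> [f [g [[f0 g0 fg gf] piE]]] K0.
by rewrite piE /counting_mass mul1r !mulr_ge0// ltW.
Qed.

(** A plan is the kernel times a function of [x] times a function of [y]: its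
    two-by-two minors relative to the kernel vanish. *)
Lemma schrodinger_plan_minor gamma nu0 nu1 pi x x' y y' :
  schrodinger_plan m L gamma nu0 nu1 pi ->
  pi x y * pi x' y' * (K gamma x y' * K gamma x' y) =
  pi x y' * pi x' y * (K gamma x y * K gamma x' y').
Proof. by move=> [f [g [_ piE]]]; rewrite !piE; ring. Qed.

Section Limit.
Variables (nu0 nu1 : lattice n -> R) (pihat : lattice n -> lattice n -> R).
Hypothesis plan : zero_temp_plan m L nu0 nu1 pihat.

(** For fixed endpoints the kernel is positive once the temperature is small
    enough, which is all that positivity of a pointwise limit requires. *)
Lemma zero_temp_plan_ge0 x y : 0 <= pihat x y.
Proof.
case: plan => pi [piP cpi]; apply: cvgr_to_ge (cpi x y) _; near=> g.
apply: schrodinger_plan_ge0; first by apply: piP; near: g; exact: nbhs_right_gt.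
by near: g; exact: heat_kernel_gt0.
Unshelve. all: by end_near. Qed.

Lemma zero_temp_plan_le x y : pihat x y <= nu0 x.
Proof.
case: plan => pi [piP cpi]; apply: cvgr_to_le (cpi x y) _; near=> g.
apply: schrodinger_plan_le1; apply: piP; near: g; exact: nbhs_right_gt.
Unshelve. all: by end_near. Qed.

(** No mass escapes in the limit: outside [Y] a plan is not positive, at any
    temperature, and inside [Y] finitely many kernels are positive at once for
    small [gamma]. *)
Lemma zero_temp_plan_marginal x (Y : seq (lattice n)) : uniq Y ->
  (forall y, y \notin Y -> nu1 y = 0) -> \sum_(y <- Y) pihat x y = nu0 x.
Proof.
case: plan => pi [piP cpi] uY Y0.
have cs : \sum_(y <- Y) pi gamma x y @[gamma --> (0:R)^'+] --> \sum_(y <- Y) pihat x y.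
  by apply: cvg_big => [|y _]; [exact: add_continuous|exact: cpi].
apply/eqP; rewrite eq_le; apply/andP; split.
  apply: cvgr_to_le cs _; near=> g.
  apply: schrodinger_plan_le => //; apply: piP; near: g; exact: nbhs_right_gt.
have Kpos : \forall g \near (0 : R)^'+, forall y, y \in Y -> 0 < K g x y.
  elim: Y {uY Y0 cs} => [|y Y IH]; first by near=> g.
  near=> g => z; rewrite inE => /predU1P[->|zY].
    by near: g; exact: heat_kernel_gt0.
  by move: z zY; near: g; exact: IH.
apply: cvgr_to_ge cs _; near=> g.
have g0 : 0 < g by near: g; exact: nbhs_right_gt.
apply: (schrodinger_plan_ge (piP _ g0)) => //.
by near: g; exact: Kpos.
Unshelve. all: by end_near. Qed.

(** Both sides of [schrodinger_plan_minor] are divided by the power of [gamma] of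
    the left-hand kernels; the ratio left on the right is [gamma ^+ e], which
    tends to 0 when exchanging the endpoints shortens the total distance. For
    [e > 0] this is two-point cyclical monotonicity; for [e = 0] it says that the
    weight [pihat / inv_facts] is multiplicative. *)
Lemma zero_temp_plan_swap x x' y y' e :
  (d x y + d x' y' = d x y' + d x' y + e)%N ->
  pihat x y * pihat x' y' * (kf x y' * kf x' y) =
  (e == 0%N)%:R * (pihat x y' * pihat x' y * (kf x y * kf x' y')).
Proof.
move=> de; case: plan => pi [piP cpi].
have cvg_minor (a a' b b' : 'rV[int]_n) :
    pi g a b * pi g a' b' * (K g a b' / g ^+ d a b' * (K g a' b / g ^+ d a' b))
      @[g --> (0 : R)^'+] --> pihat a b * pihat a' b' * (kf a b' * kf a' b).
  by apply: cvgM; apply: cvgM; exact: cpi || exact: heat_kernel_scaled_cvg.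
have cvg_pow : (fun g : R => g ^+ e) g @[g --> (0 : R)^'+] --> ((e == 0%N)%:R : R).
  rewrite -expr0n; apply: cvg_at_right_filter.
  exact: (@exprn_continuous R e 0).
have cvg_rhs := cvgM cvg_pow (cvg_minor x x' y' y).
apply: (cvg_unique _ (cvg_minor x x' y y') _) => //.
apply: cvg_trans (cvg_rhs _); apply: near_eq_cvg; near=> g.
have g0 : 0 < g by near: g; exact: nbhs_right_gt.
have M := schrodinger_plan_minor x x' y y' (piP _ g0).
rewrite /=.
transitivity (pi g x y' * pi g x' y * (K g x y * K g x' y') / g ^+ (d x y' + d x' y)).
  have : g ^+ (d x y) * g ^+ (d x' y') = g ^+ (d x y') * g ^+ (d x' y) * g ^+ e.
    by rewrite -!exprD de.
  have N k : g ^+ k != 0 by rewrite expf_neq0// gt_eqF.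
  move: (N (d x y)) (N (d x' y')) (N (d x y')) (N (d x' y)) (N e).
  rewrite exprD.
  move: (g ^+ d x y) (g ^+ d x' y') (g ^+ d x y') (g ^+ d x' y) (g ^+ e).
  move=> a b c h k a0 b0 c0 h0 k0 E.
  transitivity (k * (pi g x y' * pi g x' y * (K g x y * K g x' y')) / (a * b)).
    by field; rewrite a0 b0.
  by rewrite E; field; rewrite ?c0 ?h0 ?k0.
by rewrite -M exprD mulf_div -[LHS]mulrA.
Unshelve. all: by end_near. Qed.
End Limit.
End SchrodingerPlans.

(** * Entropy of a square *)

Lemma ln_le_sub1 (R : realType) (a : R) : 0 < a -> ln a <= a - 1.
Proof.
by move=> a0; have := @le_ln1Dx R (a - 1); rewrite subrKC; apply; lra.
Qed.

(** [q0, q1, q2, q3] are the masses at the corners of a unit square, [K] the flow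
    through the square from corner 0 to corner 3, and [C, B], [E, A] the flows
    along its two sides. The hypotheses turn the mixed logarithm into
    [- ln (A * B / (K * q3)) - ln (C * E / (K * q0))], and [ln a <= a - 1]
    applies to each term. *)
Lemma square_entropy_ge0 (R : realType) (K q0 q1 q2 q3 A B C E : R) :
  0 < K -> 0 < q0 -> 0 < q1 -> 0 < q2 -> 0 < q3 ->
  0 < A -> 0 < B -> 0 < C -> 0 < E ->
  C * B = K * q1 -> E * A = K * q2 ->
  0 <= K * (ln q3 - ln q1 - ln q2 + ln q0) + A * B / q3 + C * E / q0 - 2 * K.
Proof.
move=> K0 q00 q10 q20 q30 A0 B0 C0 E0 CB EA.
pose a := A * B / (K * q3); pose b := C * E / (K * q0).
have a0 : 0 < a by rewrite divr_gt0 ?mulr_gt0.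
have b0 : 0 < b by rewrite divr_gt0 ?mulr_gt0.
(* the four flows cancel against K ^+ 2 by the two hypotheses *)
have abE : a * b * (q3 * q0) = q1 * q2.
  have -> : a * b * (q3 * q0) = (C * B) * (E * A) / (K * K).
    by rewrite /a /b; field; rewrite !gt_eqF.
  by rewrite CB EA; field; rewrite gt_eqF.
have lnE : ln a + ln b + (ln q3 + ln q0) = ln q1 + ln q2.
  have L p q : 0 < p -> 0 < q -> ln p + ln q = ln (p * q) :> R.
    by move=> ? ?; rewrite lnM.
  by rewrite (L a b)// !(L q3, L q1)// L ?abE//; exact: mulr_gt0.
have -> : A * B / q3 = K * a by rewrite /a; field; rewrite !gt_eqF.
have -> : C * E / q0 = K * b by rewrite /b; field; rewrite !gt_eqF.
have -> : ln q3 - ln q1 - ln q2 + ln q0 = - ln a - ln b by lra.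
have -> : K * (- ln a - ln b) + K * a + K * b - 2 * K =
          K * ((a - 1 - ln a) + (b - 1 - ln b)) by ring.
by rewrite mulr_ge0 ?(ltW K0)// addr_ge0// subr_ge0 ln_le_sub1.
Qed.

(** * The flow of mass along geodesics *)
Section FiniteGeodesicFlow.
Variables (R : realType) (n : nat) (X Y : seq 'rV[int]_n).
Variable rho : 'rV[int]_n -> 'rV[int]_n -> R.
Implicit Types (x y z w v : 'rV[int]_n) (s : 'I_n * bool).
Local Notation d := (@gdist n).
Local Notation kf := (@inv_facts n R).

Hypothesis rho_ge0 : forall x y, 0 <= rho x y.
Hypothesis rho_swap : forall x x' y y' e,
  (d x y + d x' y' = d x y' + d x' y + e)%N ->
  rho x y * rho x' y' = (e == 0%N)%:R * (rho x y' * rho x' y).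

(** When [w] and [v] are at distance [j], some geodesic from [x] to [y] runs
    through [w] and then [v]. The number of steps is kept apart from the distance
    because the condition fails for larger [j]: two opposite steps, which bring
    [w] back to itself, carry no mass for [j = 2]. *)
Definition through (j : nat) w v x y := (d x w + j + d v y == d x y)%N.

(** Time dependence of the past and of the future of the bridge, as polynomials
    in the time so that derivatives are computed formally. *)
Definition arrival w x : {poly R} := kf x w *: 'X^(d x w).
Definition departure v y : {poly R} := kf v y *: (1 - 'X) ^+ d v y.

(** For [j = 0] and [w = v] this is the mass of the bridge at [w]; for [j = 1] and
    [j = 2] it is the rate at which mass crosses an edge, or a pair of successive
    edges. *)
Definition transit j w v : {poly R} :=
  \sum_(x <- X) \sum_(y <- Y)
    (rho x y * (through j w v x y)%:R)%:P * arrival w x * departure v y.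

Lemma deriv_arrival w x :
  (arrival w x)^`() =
  \sum_s ((d x (w - unit_step s)).+1 == d x w)%:R *: arrival (w - unit_step s) x.
Proof.
rewrite /arrival derivZ derivXn -scaler_nat scalerA mulrC.
have [d0|d1] := posnP (d x w).
  by rewrite d0 mul0r scale0r big1// => s _; rewrite scale0r.
rewrite -gdist_inv_factsl scaler_suml; apply: eq_bigr => s _.
by case: eqP => [<-|_]; rewrite ?scale0r ?mul0r ?scale0r// scale1r mul1r.
Qed.

Lemma deriv_departure v y :
  (departure v y)^`() =
  - \sum_s ((d (v + unit_step s) y).+1 == d v y)%:R *: departure (v + unit_step s) y.
Proof.
rewrite /departure derivZ deriv_exp derivB derivX derivC sub0r mulN1r.
rewrite mulNrn scalerN; congr (- _).
rewrite -scaler_nat scalerA mulrC.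
have [d0|d1] := posnP (d v y).
  by rewrite d0 mul0r scale0r big1// => s _; rewrite scale0r.
rewrite -gdist_inv_factsr scaler_suml; apply: eq_bigr => s _.
by case: eqP => [<-|_]; rewrite ?scale0r ?mul0r ?scale0r// scale1r mul1r.
Qed.

(** A detour would violate the triangle inequality, so prolonging a geodesic
    passage by one step is the same as starting it one step closer to [x]. *)
Lemma through_extendl j w v x y s : (d w v <= j)%N ->
  (through j w v x y && ((d x (w - unit_step s)).+1 == d x w)) =
  through j.+1 (w - unit_step s) v x y.
Proof.
move=> wv; rewrite /through; apply/andP/eqP => [[/eqP + /eqP]|E].
  by move=> <- <-; lia.
have h1 := gdist_triangle (w - unit_step s) x w.
have h2 : d (w - unit_step s) w = 1%N by rewrite -{2}(subrK (unit_step s) w) gdist_step.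
have h3 := gdist_triangle w x y; have h4 := gdist_triangle v w y.
by split; apply/eqP; lia.
Qed.

Lemma through_extendr j w v x y s : (d w v <= j)%N ->
  (through j w v x y && ((d (v + unit_step s) y).+1 == d v y)) =
  through j.+1 w (v + unit_step s) x y.
Proof.
move=> wv; rewrite /through; apply/andP/eqP => [[/eqP + /eqP]|E].
  by move=> <- <-; lia.
have h1 := gdist_triangle (v + unit_step s) v y.
have h2 := gdist_step v s.
have h3 := gdist_triangle w x y; have h4 := gdist_triangle v w y.
by split; apply/eqP; lia.
Qed.

(** Differentiating the past lets mass reach [w] by one more step;
    differentiating the future lets it leave [v] by one more step, with the
    opposite sign. *)
Lemma deriv_transit j w v : (d w v <= j)%N ->
  (transit j w v)^`() = \sum_s transit j.+1 (w - unit_step s) v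
                        - \sum_s transit j.+1 w (v + unit_step s).
Proof.
move=> wv; rewrite /transit (exchange_big _ _ X) (exchange_big _ _ X) /= -sumrB.
rewrite raddf_sum /=; apply: eq_bigr => x _.
rewrite (exchange_big _ _ Y) (exchange_big _ _ Y) /= -sumrB raddf_sum /=.
apply: eq_bigr => y _.
rewrite !derivM derivC mul0r add0r deriv_arrival deriv_departure.
rewrite mulrN !mulr_sumr mulr_suml; congr (_ - _); apply: eq_bigr => s _.
  by rewrite -through_extendl// -mulnb natrM mulrA polyCM -mul_polyC; ring.
by rewrite -through_extendr// -mulnb natrM mulrA polyCM -mul_polyC; ring.
Qed.

(** Markov property at [z]. When geodesics from [x] to [y] and from [x'] to [y']
    both pass through [z], exchanging their ends does not lengthen them, so the
    swap property makes the pairs [(x, y')] and [(x', y)] pass through [z] too,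
    with the same product of rates. If the total distances of the two matchings
    differ, the shorter one has no passage through [z] and the longer one has
    rate 0. *)
Lemma transit_rank_one i j w z v : (d w z <= i)%N -> (d z v <= j)%N ->
  transit i w z * transit j z v = transit (i + j) w v * transit 0 z z.
Proof.
move=> wz zv; apply: exchange_product_sums => x y x' y'.
rewrite -!polyCM; congr _%:P.
rewrite mulrACA [RHS]mulrACA -!natrM !mulnb /through.
have h1 := gdist_triangle w x z; have h2 := gdist_triangle z x y.
have h3 := gdist_triangle z x' y'; have h4 := gdist_triangle v z y'.
have h5 := gdist_triangle z x y'; have h6 := gdist_triangle z x' y.
case: (ltngtP (d x y + d x' y')%N (d x y' + d x' y)%N) => [lt|gt|eq].
- have [e [e0 He]] : exists e, (0 < e)%N /\
      (d x y' + d x' y = d x y + d x' y' + e)%N.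
    by exists (d x y' + d x' y - (d x y + d x' y'))%N; split; lia.
  rewrite (rho_swap He) eqn0Ngt e0 /= !mul0r.
  rewrite (_ : (_ && _) = false) ?mulr0//.
  by apply/negbTE/negP => /andP[/eqP ? /eqP ?]; lia.
- have [e [e0 He]] : exists e, (0 < e)%N /\
      (d x y + d x' y' = d x y' + d x' y + e)%N.
    by exists (d x y + d x' y' - (d x y' + d x' y))%N; split; lia.
  rewrite (rho_swap He) eqn0Ngt e0 /= !mul0r.
  rewrite (_ : (_ && _) = false) ?mulr0//.
  by apply/negbTE/negP => /andP[/eqP ? /eqP ?]; lia.
- rewrite (@rho_swap x x' y y' 0%N) ?addn0//= mul1r; congr (_ * (nat_of_bool _)%:R).
  by apply/andP/andP => -[/eqP ? /eqP ?]; split; apply/eqP; lia.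
Qed.

Lemma transitC2 w s s' :
  transit 2 w (w + unit_step s + unit_step s') =
  transit 2 w (w + unit_step s' + unit_step s).
Proof. by rewrite -!addrA (addrC (unit_step s)). Qed.

(** The passages that receive mass. It depends on the supports only, whence the
    same points are charged at all times of the open interval. *)
Definition carried (j : nat) w v : Prop :=
  exists x y, [/\ x \in X, y \in Y, 0 < rho x y & through j w v x y].

(** * The second derivative of the entropy *)

Section FixedTime.
Variable t : R.
Hypothesis t01 : 0 < t < 1.

Lemma horner_transit j w v : (transit j w v).[t] =
  \sum_(x <- X) \sum_(y <- Y) rho x y * (through j w v x y)%:R
    * (kf x w * t ^+ d x w) * (kf v y * (1 - t) ^+ d v y).
Proof.
rewrite /transit horner_sum; apply: eq_bigr => x _.
rewrite horner_sum; apply: eq_bigr => y _.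
by rewrite /arrival /departure !hornerE.
Qed.

Let t_gt0 : 0 < t. Proof. by case/andP: t01. Qed.
Let t_lt1 : 0 < 1 - t. Proof. by rewrite subr_gt0; case/andP: t01. Qed.

Lemma transit_ge0 j w v : 0 <= (transit j w v).[t].
Proof.
rewrite horner_transit; apply: sumr_ge0 => x _; apply: sumr_ge0 => y _.
by rewrite !mulr_ge0 ?exprn_ge0 ?(ltW t_gt0) ?(ltW t_lt1) ?rho_ge0
  ?(ltW (inv_facts_gt0 _ _ _)).
Qed.

Lemma transit_gt0 j w v : carried j w v -> 0 < (transit j w v).[t].
Proof.
move=> [x [y [xX yY r0 th]]]; rewrite lt_neqAle transit_ge0 andbT eq_sym.
rewrite horner_transit.
have ge0 x' y' : 0 <= rho x' y' * (through j w v x' y')%:R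
    * (kf x' w * t ^+ d x' w) * (kf v y' * (1 - t) ^+ d v y').
  by rewrite !mulr_ge0 ?exprn_ge0 ?(ltW t_gt0) ?(ltW t_lt1) ?rho_ge0
  ?(ltW (inv_facts_gt0 _ _ _)).
apply/negP; rewrite psumr_eq0 => [/allP/(_ x xX)/=|x' _]; last exact: sumr_ge0.
rewrite psumr_eq0 => [/allP/(_ y yY)/=|//].
by rewrite th mulr1 gt_eqF// !mulr_gt0 ?exprn_gt0 ?inv_facts_gt0.
Qed.

Lemma transit_eq0 j w v : ~ carried j w v -> transit j w v = 0.
Proof.
move=> nc; rewrite /transit big1_seq// => x /andP[_ xX].
rewrite big1_seq// => y /andP[_ yY].
case: (boolP (through j w v x y)) => [th|]; last by rewrite mulr0 !mul0r.
have := rho_ge0 x y; rewrite le_eqVlt => /predU1P[<-|r0].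
  by rewrite !mul0r.
by case: nc; exists x, y.
Qed.

Lemma carried_sub i l j w p q v :
  (d w p <= i)%N -> (d p q <= l)%N -> (d q v <= j)%N ->
  carried (i + l + j) w v -> carried l p q.
Proof.
move=> wp pq qv [x [y [xX yY r0 /eqP th]]]; exists x, y; split=> //.
have h1 := gdist_triangle w x p; have h2 := gdist_triangle v q y.
have h3 := gdist_triangle p x y; have h4 := gdist_triangle q p y.
by apply/eqP; lia.
Qed.

(* The radius 2 keeps all corners of the squares met below inside the window. *)
Variable V : seq 'rV[int]_n.
Hypothesis uniqV : uniq V.
Hypothesis V_nbhs : forall z u, carried 0 z z -> (d z u <= 2)%N -> u \in V.

Let Q z := (transit 0 z z).[t].
Let J z s := (transit 1 z (z + unit_step s)).[t].
Let K z s s' := (transit 2 z (z + unit_step s + unit_step s')).[t].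

Let inflow z := \sum_s J (z - unit_step s) s.
Let outflow z := \sum_s J z s.

Lemma deriv_marginal z : (transit 0 z z)^`().[t] = inflow z - outflow z.
Proof.
rewrite deriv_transit ?gdistxx// hornerD hornerN !horner_sum.
by congr (_ - _); apply: eq_bigr => s _; rewrite /J ?subrK.
Qed.

(** Each pair of steps [s, s'] spans a square, along which the second derivative
    is a mixed second difference. *)
Lemma deriv2_marginal z : (transit 0 z z)^`()^`().[t] =
  \sum_s \sum_s' (K (z - unit_step s' - unit_step s) s s' - K (z - unit_step s) s s'
     - K (z - unit_step s') s s' + K z s s').
Proof.
have dsum (F : 'I_n * bool -> {poly R}) : (\sum_s F s)^`() = \sum_s (F s)^`().
  exact: raddf_sum.
rewrite deriv_transit ?gdistxx// derivB !dsum hornerD hornerN !horner_sum -sumrB.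
apply: eq_bigr => s _.
rewrite !deriv_transit ?gdist_step//; last first.
  by rewrite -{2}(subrK (unit_step s) z) gdist_step.
rewrite !(hornerD, hornerN) !horner_sum -!sumrB; apply: eq_bigr => s' _.
rewrite /K !subrK (addrAC (z - unit_step s')) subrK (addrAC z (- unit_step s')).
by rewrite opprD opprK addrA.
Qed.

Lemma twostep_carried z s s' : K z s s' != 0 -> carried 2 z (z + unit_step s + unit_step s').
Proof. by move=> K0; apply: contrapT => /transit_eq0 E; rewrite /K E horner0 eqxx in K0. Qed.

Lemma flux_carried z s : J z s != 0 -> carried 1 z (z + unit_step s).
Proof. by move=> K0; apply: contrapT => /transit_eq0 E; rewrite /J E horner0 eqxx in K0. Qed.

Lemma flux_carriedr z s : J (z - unit_step s) s != 0 -> carried 0 z z.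
Proof.
move/flux_carried/(@carried_sub 1 0 0 _ z z); rewrite subrK; apply; rewrite ?gdistxx//.
by rewrite -{2}(subrK (unit_step s) z) gdist_step.
Qed.

Lemma gdist_sub_step z s : d z (z - unit_step s) = 1%N.
Proof. by rewrite gdistC -{2}(subrK (unit_step s) z) gdist_step. Qed.

Lemma gdist_sub_steps z s s' : (d z (z - unit_step s' - unit_step s)%R <= 2)%N.
Proof.
by apply: leq_trans (gdist_triangle (z - unit_step s') _ _) _; rewrite !gdist_sub_step.
Qed.

Lemma sum_corner s s' a (c : 'rV[int]_n -> R) :
  (a = 0 \/ a = unit_step s \/ a = unit_step s' \/ a = unit_step s + unit_step s') ->
  \sum_(z <- V) K (z - a) s s' * c z = \sum_(w <- V) K w s s' * c (w + a).
Proof.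
move=> ha.
have da w : (d w (w + a)%R <= 2)%N.
  case: ha => [->|[->|[->|->]]]; rewrite ?addr0 ?gdistxx ?gdist_step//.
  by rewrite addrA gdist_steps.
rewrite -(@sum_shift _ _ V a (fun z => K (z - a) s s' * c z))//.
- by apply: eq_bigr => w _; rewrite addrK.
- move=> z; rewrite mulf_eq0 negb_or => /andP[/twostep_carried h _].
  apply: (@V_nbhs (z - a)); last by rewrite -{2}(subrK a z).
  by apply: (@carried_sub 0 0 2 _ _ _ _ _ _ _ h); rewrite ?gdistxx ?gdist_steps.
- move=> z; rewrite mulf_eq0 negb_or => /andP[/twostep_carried h _].
  apply: (@V_nbhs (z - a)); rewrite ?gdistxx//.
  by apply: (@carried_sub 0 0 2 _ _ _ _ _ _ _ h); rewrite ?gdistxx ?gdist_steps.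
Qed.

(** Summation by parts moves the mixed differences onto the test function. *)
Lemma sum_deriv2 (c : 'rV[int]_n -> R) :
  \sum_(z <- V) (transit 0 z z)^`()^`().[t] * c z =
  \sum_s \sum_s' \sum_(w <- V) K w s s' *
    (c (w + unit_step s + unit_step s') - c (w + unit_step s)
     - c (w + unit_step s') + c w).
Proof.
under eq_bigr do rewrite deriv2_marginal mulr_suml.
rewrite exchange_big; apply: eq_bigr => s _ /=.
under eq_bigr do rewrite mulr_suml.
rewrite exchange_big; apply: eq_bigr => s' _ /=.
have split4l (k1 k2 k3 k4 : 'rV[int]_n -> R) :
    \sum_(z <- V) (k1 z - k2 z - k3 z + k4 z) * c z =
    \sum_(z <- V) k1 z * c z - \sum_(z <- V) k2 z * c z
    - \sum_(z <- V) k3 z * c z + \sum_(z <- V) k4 z * c z.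
  by rewrite -!sumrB -big_split; apply: eq_bigr => z _ /=; ring.
have split4r (k c1 c2 c3 c4 : 'rV[int]_n -> R) :
    \sum_(z <- V) k z * (c1 z - c2 z - c3 z + c4 z) =
    \sum_(z <- V) k z * c1 z - \sum_(z <- V) k z * c2 z
    - \sum_(z <- V) k z * c3 z + \sum_(z <- V) k z * c4 z.
  by rewrite -!sumrB -big_split; apply: eq_bigr => z _ /=; ring.
rewrite (split4l (fun z => K (z - unit_step s' - unit_step s) s s')
  (fun z => K (z - unit_step s) s s') (fun z => K (z - unit_step s') s s')).
rewrite (split4r (fun w => K w s s')
  (fun w => c (w + unit_step s + unit_step s'))
  (fun w => c (w + unit_step s)) (fun w => c (w + unit_step s'))).
congr (_ - _ - _ + _).
- under eq_bigr do rewrite -addrA -opprD (addrC (unit_step s')).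
  by rewrite sum_corner; [apply: eq_bigr => w _; rewrite addrA | tauto].
- by rewrite sum_corner; tauto.
- by rewrite sum_corner; tauto.
Qed.

Lemma sum_inflow2 : \sum_(z <- V) inflow z ^+ 2 / Q z =
  \sum_s \sum_s' \sum_(w <- V)
    J (w + unit_step s') s * J (w + unit_step s) s' / Q (w + unit_step s + unit_step s').
Proof.
under eq_bigr do rewrite expr2 /inflow big_distrlr /= mulr_suml.
rewrite exchange_big; apply: eq_bigr => s _ /=.
under eq_bigr do rewrite mulr_suml.
rewrite exchange_big; apply: eq_bigr => s' _ /=.
pose g z := J (z - unit_step s) s * J (z - unit_step s') s' / Q z.
rewrite -[LHS](@sum_shift _ _ V (unit_step s + unit_step s') g)//.
- apply: eq_bigr => w _; rewrite /g !addrA addrK.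
  by rewrite (addrAC w) addrK.
- move=> z; rewrite /g !mulf_eq0 !negb_or -andbA => /and3P[h _ _].
  by apply: (@V_nbhs z); [exact: flux_carriedr h|rewrite gdistxx].
- move=> z; rewrite /g !mulf_eq0 !negb_or -andbA => /and3P[h _ _].
  apply: (@V_nbhs z); [exact: flux_carriedr h|].
  by rewrite opprD addrA addrAC gdist_sub_steps.
Qed.

Lemma sum_outflow2 : \sum_(z <- V) outflow z ^+ 2 / Q z =
  \sum_s \sum_s' \sum_(w <- V) J w s * J w s' / Q w.
Proof.
under eq_bigr do rewrite expr2 /outflow big_distrlr /= mulr_suml.
rewrite exchange_big; apply: eq_bigr => s _ /=.
under eq_bigr do rewrite mulr_suml.
by rewrite exchange_big.
Qed.

Lemma flow_rank_one w s s' :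
  J w s * J (w + unit_step s) s' = K w s s' * Q (w + unit_step s).
Proof.
by rewrite /J /K /Q -!hornerM transit_rank_one ?gdist_step.
Qed.

(** By the Markov property at [z], the mass entering [z] by [s] and leaving it by
    [s'] is the flow through the two successive edges. *)
Lemma sum_inflow_outflow : \sum_(z <- V) inflow z * outflow z / Q z =
  \sum_s \sum_s' \sum_(w <- V) K w s s'.
Proof.
under eq_bigr do rewrite /outflow big_distrlr /= mulr_suml.
rewrite exchange_big; apply: eq_bigr => s _ /=.
under eq_bigr do rewrite mulr_suml.
rewrite exchange_big; apply: eq_bigr => s' _ /=.
transitivity (\sum_(z <- V) K (z - unit_step s) s s' * 1); last first.
  by rewrite sum_corner; [apply: eq_bigr => w _; rewrite mulr1|tauto].
apply: eq_bigr => z _; have := flow_rank_one (z - unit_step s) s s'.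
rewrite subrK mulr1 => ->.
have [Q0|Q0] := eqVneq (Q z) 0; last by rewrite mulfK.
rewrite Q0 mulr0 mul0r; apply/esym/eqP; apply: contrapT => /negP/twostep_carried h.
have := @carried_sub 1 0 1 _ z z _ _ _ _ h; rewrite gdistxx subrK gdist_step.
rewrite gdistC gdist_sub_step => /(_ isT isT isT)/transit_gt0.
by rewrite -/(Q z) Q0 ltxx.
Qed.

Lemma square_term_ge0 w s s' :
  0 <= K w s s' *
    ((ln (Q (w + unit_step s + unit_step s')) + 1) - (ln (Q (w + unit_step s)) + 1)
     - (ln (Q (w + unit_step s')) + 1) + (ln (Q w) + 1))
   + J (w + unit_step s') s * J (w + unit_step s) s' / Q (w + unit_step s + unit_step s')
   + J w s * J w s' / Q w - 2 * K w s s'.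
Proof.
have [K0|K0] := eqVneq (K w s s') 0.
  rewrite K0 mul0r mulr0 subr0 add0r.
  by rewrite addr_ge0 ?divr_ge0 ?mulr_ge0 ?transit_ge0.
have h := twostep_carried K0.
have h' : carried 2 w (w + unit_step s' + unit_step s) by rewrite addrAC.
have -> (a b c e : R) : (a + 1) - (b + 1) - (c + 1) + (e + 1) = a - b - c + e by ring.
apply: square_entropy_ge0.
- exact: transit_gt0.
- by apply/transit_gt0/(@carried_sub 0 0 2 _ _ _ _ _ _ _ h); rewrite ?gdistxx ?gdist_steps.
- by apply/transit_gt0/(@carried_sub 1 0 1 _ _ _ _ _ _ _ h); rewrite ?gdistxx ?gdist_step.
- by apply/transit_gt0/(@carried_sub 1 0 1 _ _ _ _ _ _ _ h'); rewrite ?gdistxx ?gdist_step.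
- by apply/transit_gt0/(@carried_sub 2 0 0 _ _ _ _ _ _ _ h); rewrite ?gdistxx ?gdist_steps.
- by apply/transit_gt0/(@carried_sub 1 1 0 _ _ _ _ _ _ _ h'); rewrite ?gdistxx ?gdist_step.
- by apply/transit_gt0/(@carried_sub 1 1 0 _ _ _ _ _ _ _ h); rewrite ?gdistxx ?gdist_step.
- by apply/transit_gt0/(@carried_sub 0 1 1 _ _ _ _ _ _ _ h); rewrite ?gdistxx ?gdist_step.
- by apply/transit_gt0/(@carried_sub 0 1 1 _ _ _ _ _ _ _ h'); rewrite ?gdistxx ?gdist_step.
- exact: flow_rank_one.
- by rewrite flow_rank_one /K transitC2.
Qed.

(** The squares of [inflow] and [outflow] expand over pairs of steps and, after a
    translation, supply the two positive quotients of [square_term_ge0]; the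
    cross term supplies the negative one. *)
Lemma entropy_deriv2_ge0 :
  0 <= \sum_(z <- V) ((transit 0 z z)^`()^`().[t] * (ln (Q z) + 1)
                      + (transit 0 z z)^`().[t] ^+ 2 / Q z).
Proof.
rewrite big_split /= sum_deriv2.
under [X in _ + X]eq_bigr => z _.
  rewrite deriv_marginal.
  have -> : (inflow z - outflow z) ^+ 2 / Q z = inflow z ^+ 2 / Q z
    + outflow z ^+ 2 / Q z - 2 * (inflow z * outflow z / Q z) by ring.
  over.
rewrite !big_split /= sumrN -mulr_sumr.
rewrite sum_inflow2 sum_outflow2 sum_inflow_outflow !addrA.
rewrite mulr_sumr -!big_split /= -sumrB; apply: sumr_ge0 => s _.
rewrite mulr_sumr -!big_split /= -sumrB; apply: sumr_ge0 => s' _.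
rewrite mulr_sumr -!big_split /= -sumrB; apply: sumr_ge0 => w _.
exact: square_term_ge0.
Qed.
End FixedTime.
End FiniteGeodesicFlow.

(** * Convexity from the second derivative *)

(** Sublinearity of [ln] at [1 / sqrt x] gives [- ln x <= 2 / sqrt x]. *)
Lemma norm_xlnx_le (R : realType) (x : R) :
  x < 1 -> `|x * ln x| <= 2 * Num.sqrt x.
Proof.
move=> x1; have [x0|x0] := leP x 0.
  by rewrite ln0// mulr0 normr0 mulr_ge0 ?sqrtr_ge0.
set s := Num.sqrt x; have s0 : 0 < s by rewrite sqrtr_gt0.
have xE : x = s ^+ 2 by rewrite sqr_sqrtr ?ltW.
have s1 : s < 1 by rewrite -(@ltr_pXn2r _ 2%N) ?nnegrE ?ltW// expr1n -xE.
rewrite xE lnXn// normrM (ger0_norm (sqr_ge0 s)) ler0_norm; last first.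
  by rewrite mulrn_wle0// ln_le0// ltW.
have : - ln s <= s^-1 by rewrite -lnV ?posrE// ltW// ln_sublinear// invr_gt0.
move=> h; rewrite [leLHS](_ : _ = 2 * (s * (s * - ln s))); last by ring.
rewrite ler_pM2l// -[leRHS]mulr1 ler_pM2l//.
by rewrite -(mulfV (lt0r_neq0 s0)) ler_pM2l.
Qed.

Lemma xlnx_continuous (R : realType) : continuous (fun x : R => x * ln x).
Proof.
move=> x; have [x0|x0|->] := ltrgtP x 0.
- apply: (near_cst_continuous 0); near=> y; rewrite ln0 ?mulr0// ltW//.
  by near: y; exact: lt_nbhsl.
- by apply: (@continuousM _ _ id (@ln R) x); [exact: cvg_id|exact: continuous_ln].
- rewrite /continuous_at mul0r; apply/norm_cvg0P.
  apply: (@squeeze_cvgr _ _ _ _ (cst 0) (fun y => 2 * Num.sqrt y)).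
  + near=> y; rewrite normr_ge0 /= norm_xlnx_le//.
    by near: y; exact: lt_nbhsl.
  + exact: cvg_cst.
  + have h : (fun y : R => 2 * Num.sqrt y) y @[y --> (0 : R)] --> 2 * Num.sqrt (0 : R).
      by apply: cvgM; [exact: cvg_cst|exact: sqrt_continuous].
    by rewrite sqrtr0 mulr0 in h.
Unshelve. all: by end_near. Qed.

Lemma is_derive_seq_sum (R : realType) (T : Type) (r : seq T) (f : T -> R -> R)
    (df : T -> R) (t : R) :
  (forall z, is_derive t 1 (f z) (df z)) ->
  is_derive t 1 (fun u => \sum_(z <- r) f z u) (\sum_(z <- r) df z).
Proof.
move=> fdf; elim: r => [|z r IH].
  rewrite big_nil (_ : (fun _ => _) = cst 0); first exact: is_derive_cst.
  by apply/funext => u; rewrite big_nil.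
rewrite big_cons (_ : (fun _ => _) = f z + (fun u => \sum_(z <- r) f z u)).
  exact: is_deriveD.
by apply/funext => u; rewrite big_cons.
Qed.

Section EntropyOfPolynomials.
Variables (R : realType) (T : Type) (r : seq T) (P : T -> {poly R}).
(* At points that carry no mass the polynomial vanishes identically and the
   corresponding term is constant. *)
Hypothesis P_gt0 : forall z, P z = 0 \/ forall t, 0 < t < 1 -> 0 < (P z).[t].

Let H (t : R) : R := \sum_(z <- r) (P z).[t] * ln (P z).[t].
Let dH (t : R) : R := \sum_(z <- r) (P z)^`().[t] * (ln (P z).[t] + 1).
Let ddH (t : R) : R := \sum_(z <- r)
  ((P z)^`()^`().[t] * (ln (P z).[t] + 1) + (P z)^`().[t] ^+ 2 / (P z).[t]).

Lemma is_derive_ln_horner (p : {poly R}) (t : R) : 0 < p.[t] ->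
  is_derive t 1 (fun u => ln p.[u]) (p^`().[t] / p.[t]).
Proof.
move=> p0; rewrite mulrC.
exact: (@is_derive1_comp _ _ (horner p) t _ _ (is_derive1_ln p0) (is_derive_poly p t)).
Qed.

Lemma is_derive_entropy (t : R) : 0 < t < 1 -> is_derive t 1 H (dH t).
Proof.
move=> t01; apply: is_derive_seq_sum => z.
have [->|/(_ _ t01) p0] := P_gt0 z.
  rewrite (_ : (fun _ => _) = cst 0); last by apply/funext=> u; rewrite horner0 mul0r.
  by rewrite deriv0 horner0 mul0r; exact: is_derive_cst.
have dl := is_derive_ln_horner p0.
have h := is_deriveM (is_derive_poly (P z) t) dl.
apply: (is_derive_eq h).
by rewrite /GRing.scale /=; field; rewrite gt_eqF.
Qed.

Lemma is_derive_entropy2 (t : R) : 0 < t < 1 -> is_derive t 1 dH (ddH t).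
Proof.
move=> t01; apply: is_derive_seq_sum => z.
have [->|/(_ _ t01) p0] := P_gt0 z.
  rewrite (_ : (fun _ => _) = cst 0); last first.
    by apply/funext=> u; rewrite deriv0 horner0 mul0r.
  rewrite !deriv0 horner0 mul0r expr2 !mul0r addr0; exact: is_derive_cst.
have dl := is_derive_ln_horner p0.
have dl1 := is_deriveD dl (is_derive_cst (1 : R) t 1).
have h := is_deriveM (is_derive_poly (P z)^`() t) dl1.
apply: (is_derive_eq h).
rewrite /GRing.scale /= !fctE /=. by field; rewrite gt_eqF.
Qed.

Lemma entropy_continuous : continuous H.
Proof.
rewrite /H; elim: r => [|z r' IH].
  rewrite (_ : (fun _ => _) = cst 0); first by move=> t; exact: cvg_cst.
  by apply/funext => u; rewrite big_nil.
rewrite (_ : (fun _ => _) = fun t => (P z).[t] * ln (P z).[t] +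
   \sum_(z <- r') (P z).[t] * ln (P z).[t]).
  move=> t; apply: cvgD; last exact: IH.
  apply: (@continuous_comp _ _ _ (horner (P z)) (fun x => x * ln x)).
    exact: continuous_horner.
  exact: xlnx_continuous.
by apply/funext => u; rewrite big_cons.
Qed.

Hypothesis ddH_ge0 : forall t, 0 < t < 1 -> 0 <= ddH t.

Lemma entropy_convex : @convex_function R R^o `[0, 1] (H : R -> R^o).
Proof.
have near01 (t : R) : 0 < t < 1 -> \forall u \near t, 0 < u < 1.
  move=> /andP[t0 t1]; near=> u; apply/andP; split; near: u.
    exact: lt_nbhsr.
  exact: lt_nbhsl.
have D1 (t : R) : 0 < t < 1 -> 'D_1 H t = dH t.
  by move=> /is_derive_entropy h; rewrite derive_val.
have D2 (t : R) : 0 < t < 1 -> is_derive t 1 ('D_1 H) (ddH t).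
  move=> t01; apply: near_eq_is_derive (is_derive_entropy2 t01).
  by near=> u; rewrite D1//; near: u; exact: near01.
have cvx (a b : R) (k : {i01 R}) : 0 <= a -> b <= 1 -> a <= b ->
    (H (conv k (a : R^o) (b : R^o)) <= conv k (H a : R^o) (H b : R^o))%R.
  move=> a0 b1 ab.
  have in01 (t : R) : a < t < b -> 0 < t < 1.
    by move=> /andP[? ?]; rewrite (le_lt_trans a0)//= (lt_le_trans _ b1).
  apply: (@second_derivative_convex R H a b) => //.
  - move=> x /in01 x01; have := D2 _ x01 => h.
    by rewrite derive_val ddH_ge0.
  - by apply: cvg_at_left_filter; exact: entropy_continuous.
  - by apply: cvg_at_right_filter; exact: entropy_continuous.
  - move=> x; rewrite in_itv /= => /in01 /is_derive_entropy h.
    exact: ex_derive.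
  - move=> x; rewrite in_itv /= => /in01 /D2 h.
    exact: ex_derive.
move=> k x y; rewrite !inE /= !in_itv /= => /andP[x0 x1] /andP[y0 y1].
have [xy|yx] := leP x y; first exact: cvx.
by rewrite convC [leRHS]convC; apply: cvx => //; exact: ltW.
Unshelve. all: by end_near. Qed.
End EntropyOfPolynomials.

(** * The bridge at zero temperature *)
Lemma gdist_ball_finite n (x : 'rV[int]_n) (D : nat) :
  exists r : seq 'rV[int]_n, forall u, (gdist x u <= D)%N -> u \in r.
Proof.
pose shift (f : {ffun 'I_n -> 'I_(D + D).+1}) : 'rV[int]_n :=
  x + \row_i ((f i)%:Z - D%:Z).
exists [seq shift f | f : {ffun 'I_n -> 'I_(D + D).+1}] => u xu.
have ui i : (absz (u 0%R i - x 0%R i) <= D)%N.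
  by apply: leq_trans xu; rewrite /gdist (bigD1 i)//= leq_addr.
apply/fintype.imageP; exists [ffun i => inord (absz (u 0 i - x 0 i + D%:Z)%R)] => //.
apply/rowP => i; rewrite !mxE ffunE; move: (u 0 i) (x 0 i) (ui i) => a b ab.
by rewrite inordK; lia.
Qed.

Section BridgeOfPlan.
Variables (R : realType) (n : nat).
Implicit Types (x y z : 'rV[int]_n).
Local Notation d := (@gdist n).
Local Notation kf := (@inv_facts n R).
Local Notation L := (@lattice_generator R n).
Local Notation m := (@counting_mass R n).
Variables (nu0 nu1 : lattice n -> R) (pihat : lattice n -> lattice n -> R).
Hypothesis plan : zero_temp_plan m L nu0 nu1 pihat.
Variables X Y : seq 'rV[int]_n.
Hypotheses (uniqX : uniq X) (uniqY : uniq Y).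
Hypothesis (nu0X : forall x, x \notin X -> nu0 x = 0).
Hypothesis (nu1Y : forall y, y \notin Y -> nu1 y = 0).

Definition rate x y : R := pihat x y / kf x y.
Local Notation marginal z := (transit X Y rate 0 z z).

Lemma rate_ge0 x y : 0 <= rate x y.
Proof.
by rewrite divr_ge0 ?(zero_temp_plan_ge0 plan)// ltW// inv_facts_gt0.
Qed.

Lemma rate_swap x x' y y' e :
  (d x y + d x' y' = d x y' + d x' y + e)%N ->
  rate x y * rate x' y' = (e == 0%N)%:R * (rate x y' * rate x' y).
Proof.
move=> /(zero_temp_plan_swap plan); rewrite /rate.
have N a b : kf a b != 0 by rewrite gt_eqF// inv_facts_gt0.
move: (N x y) (N x' y') (N x y') (N x' y).
move: (kf x y) (kf x' y') (kf x y') (kf x' y) => a b c h a0 b0 c0 h0 E.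
transitivity (pihat x y * pihat x' y' * (c * h) / (a * b * c * h)).
  by field; rewrite a0 b0 c0 h0.
by rewrite E; field; rewrite a0 b0 c0 h0.
Qed.

Lemma plan_outl x y : x \notin X -> pihat x y = 0.
Proof.
move=> /nu0X x0; apply/eqP; rewrite eq_le (zero_temp_plan_ge0 plan) andbT.
by rewrite -x0 (zero_temp_plan_le plan).
Qed.

Lemma plan_outr x y : y \notin Y -> pihat x y = 0.
Proof.
move=> /nu1Y y0; apply/eqP; rewrite eq_le (zero_temp_plan_ge0 plan) andbT.
by rewrite -y0 (zero_temp_plan_le (zero_temp_planC plan)).
Qed.

(** At fixed endpoints the bridge has weight [inv_facts x z * inv_facts z y] over
    [inv_facts x y], and the denominator is absorbed in [rate]. *)
Lemma mixture_bridge_marginal t z : mixture_bridge pihat t z = (marginal z).[t].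
Proof.
rewrite /mixture_bridge (@fsum_seq _ _ X)//; last first.
  move=> x; apply: contraNT => xX.
  by rewrite fsbig1// => y _; rewrite plan_outl// mulr0.
rewrite horner_transit; apply: eq_bigr => x _.
rewrite (@fsum_seq _ _ Y)//; last first.
  by move=> y; apply: contraNT => yY; rewrite plan_outr// mulr0.
apply: eq_bigr => y _; rewrite /point_bridge indicE.
have -> : (z \in geodesics x y) = through 0 z z x y.
  rewrite /through addn0; apply/idP/eqP; rewrite inE //.
case: (boolP (through 0 z z x y)) => [th|_]; last by rewrite mulr0 !mul0r.
have xzy : (d x z + d z y = d x y)%N by move: th; rewrite /through addn0 => /eqP.
have N : kf x y != 0 by rewrite gt_eqF// inv_facts_gt0.
rewrite -[X in _ * X * _ * _](mulfK N) (inv_facts_binomial R xzy) /rate.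
move: (kf x y)^-1 (kf x z) (kf z y) (t ^+ _) ((1 - t) ^+ _) => a b c e h.
by ring.
Qed.

Lemma mixture_bridge0 z : mixture_bridge pihat 0 z = nu0 z.
Proof.
rewrite mixture_bridge_marginal horner_transit.
have out x : x != z -> \sum_(y <- Y) rate x y * (through 0 z z x y)%:R
    * (kf x z * 0 ^+ d x z) * (kf z y * (1 - 0) ^+ d z y) = 0.
  move=> xz; rewrite big1// => y _.
  by rewrite expr0n gdist_eq0 (negbTE xz) !(mulr0, mul0r).
case: (boolP (z \in X)) => [zX|zX]; last first.
  rewrite nu0X// big1_seq// => x /andP[_ xX]; apply: out.
  by apply: contraNneq zX => <-.
rewrite (bigD1_seq z)//= [X in _ + X]big1 ?addr0//.
rewrite -(zero_temp_plan_marginal plan _ uniqY)//; apply: eq_bigr => y _.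
rewrite /through gdistxx eqxx inv_factsxx expr0 subr0 expr1n !mulr1.
by rewrite /rate divfK// gt_eqF// inv_facts_gt0.
Qed.

Lemma mixture_bridge1 z : mixture_bridge pihat 1 z = nu1 z.
Proof.
rewrite mixture_bridge_marginal horner_transit exchange_big /=.
have out y : y != z -> \sum_(x <- X) rate x y * (through 0 z z x y)%:R
    * (kf x z * 1 ^+ d x z) * (kf z y * (1 - 1) ^+ d z y) = 0.
  move=> yz; rewrite big1// => x _.
  by rewrite subrr expr0n gdist_eq0 eq_sym (negbTE yz) !(mulr0, mul0r).
case: (boolP (z \in Y)) => [zY|zY]; last first.
  rewrite nu1Y// big1_seq// => y /andP[_ yY]; apply: out.
  by apply: contraNneq zY => <-.
rewrite (bigD1_seq z)//= [X in _ + X]big1 ?addr0//.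
rewrite -(zero_temp_plan_marginal (zero_temp_planC plan) _ uniqX)//.
apply: eq_bigr => x _.
rewrite /through gdistxx addn0 addn0 eqxx inv_factsxx subrr expr0 expr1n !mulr1.
by rewrite /rate divfK// gt_eqF// inv_facts_gt0.
Qed.

Lemma carried_nbhs_finite : exists V : seq 'rV[int]_n, uniq V /\
  forall z u, carried X Y rate 0 z z -> (d z u <= 2)%N -> u \in V.
Proof.
pose D := (\max_(x <- X) \max_(y <- Y) d x y)%N.
have [r rP] : exists r : seq 'rV[int]_n,
    forall x u, x \in X -> (d x u <= D + 2)%N -> u \in r.
  elim: (X) => [|x X' [r rP]]; first by exists [::].
  have [r' r'P] := gdist_ball_finite x (D + 2).
  exists (r' ++ r) => x' u; rewrite inE mem_cat => /predU1P[->|x'X] xu.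
    by rewrite r'P.
  by rewrite (rP x')// orbT.
exists (undup r); split=> [|z u]; first exact: undup_uniq.
move=> [x [y [xX yY _ /eqP th]]] zu; rewrite mem_undup; apply: (rP x) => //.
apply: leq_trans (gdist_triangle z _ _) _; rewrite leq_add//.
have: (d x y <= D)%N.
  apply: leq_trans (leq_bigmax_seq _ yY isT) _.
  exact: (@leq_bigmax_seq _ X xpredT (fun x => \max_(y <- Y) d x y)%N).
by lia.
Qed.

Lemma bridge_entropy_convex (Q : R -> lattice n -> R) :
  (forall t, 0 <= t <= 1 -> forall z, Q t z = mixture_bridge pihat t z) ->
  @convex_function R R^o `[0, 1] (fun t : R => rel_entropy m (Q t)).
Proof.
move=> QE; have [V [uV VP]] := carried_nbhs_finite.
pose H (t : R) : R := \sum_(z <- V) (marginal z).[t] * ln (marginal z).[t].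
have HE (t : R) : 0 <= t <= 1 -> rel_entropy m (Q t) = H t.
  move=> t01; rewrite /rel_entropy (@fsum_seq _ _ V)//.
    apply: eq_bigr => z _; rewrite /counting_mass divr1 QE//.
    by rewrite mixture_bridge_marginal.
  move=> z; rewrite QE// mixture_bridge_marginal mulf_eq0 negb_or => /andP[+ _].
  move=> h; apply: (VP z); rewrite ?gdistxx//.
  apply: contrapT => /(transit_eq0 rate_ge0) E.
  by rewrite E horner0 eqxx in h.
have Hcvx : @convex_function R R^o `[0, 1] (H : R -> R^o).
  apply: entropy_convex => [z|t t01].
    have [/(transit_eq0 rate_ge0)|c] := pselect (~ carried X Y rate 0 z z); first by left.
    right=> t t01; apply: transit_gt0 => //; [exact: rate_ge0|].
    exact: contrapT.
  exact: (entropy_deriv2_ge0 rate_ge0 rate_swap t01 uV VP).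
move=> k x y x01 y01.
have in01 (t : R^o) : t \in (`[0, 1]%classic : set R) -> 0 <= t <= 1.
  by rewrite inE /= in_itv.
rewrite (HE x) ?in01// (HE y) ?in01// HE; first exact: Hcvx.
have /andP[x0 x1] := in01 _ x01; have /andP[y0 y1] := in01 _ y01.
have /andP[k0 k1] : 0 <= k%:num <= 1 by rewrite ge0 le1.
change (0 <= k%:num * (x : R) + (1 - k%:num) * (y : R) <= 1); apply/andP; split.
  by rewrite addr_ge0// mulr_ge0// subr_ge0.
rewrite [leRHS](_ : 1 = k%:num * 1 + (1 - k%:num) * 1); last by rewrite !mulr1 subrKC.
by rewrite lerD// ler_wpM2l// subr_ge0.
Qed.
End BridgeOfPlan.

Theorem theorem2p3 (R : realType) (n : nat) (hn : (1 <= n)%N)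
    (nu0 nu1 : lattice n -> R)
    (hnu0 : finite_proba nu0) (hnu1 : finite_proba nu1)
    (Q : R -> lattice n -> R)
    (hQ : zero_temp_bridge (@counting_mass R n) (@lattice_generator R n)
            nu0 nu1 Q) :
  (forall t : R, 0 < t < 1 ->
     rel_entropy (@counting_mass R n) (Q t)
     <= (1 - t) * rel_entropy (@counting_mass R n) nu0
        + t * rel_entropy (@counting_mass R n) nu1) /\
  @convex_function R R^o `[0, 1]
    (fun t : R => rel_entropy (@counting_mass R n) (Q t)).
Proof.
case: hnu0 hnu1 hQ => [_ fin0 _] [_ fin1 _] [pihat [plan QE]].
pose X : seq 'rV[int]_n := finmap.enum_fset (fset_set [set z | nu0 z != 0]).
pose Y : seq 'rV[int]_n := finmap.enum_fset (fset_set [set z | nu1 z != 0]).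
have uX : uniq X by exact: finmap.fset_uniq.
have uY : uniq Y by exact: finmap.fset_uniq.
have X0 x : x \notin X -> nu0 x = 0.
  by apply: contraNeq => x0; rewrite /X in_fset_set// inE.
have Y0 y : y \notin Y -> nu1 y = 0.
  by apply: contraNeq => y0; rewrite /Y in_fset_set// inE.
have cvx := bridge_entropy_convex plan uX uY X0 Y0 QE.
split=> // t /andP[t0 t1].
have Q0 : Q 0 = nu0.
  apply/funext => z; rewrite QE ?lexx ?ler01//.
  exact: (mixture_bridge0 plan uX uY X0 Y0).
have Q1 : Q 1 = nu1.
  apply/funext => z; rewrite QE ?lexx ?ler01//.
  exact: (mixture_bridge1 plan uX uY X0 Y0).
have in01 (u : R) : 0 <= u <= 1 -> (u : R^o) \in (`[0, 1]%classic : set R).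
  by move=> u01; rewrite inE /= in_itv.
pose k : {i01 R} := Itv01 (ltW t0) (ltW t1).
have : rel_entropy (@counting_mass R n) (Q (t * 1 + (1 - t) * 0))
    <= t * rel_entropy (@counting_mass R n) (Q 1)
       + (1 - t) * rel_entropy (@counting_mass R n) (Q 0).
  by apply: (cvx k 1 0); apply: in01; rewrite ?lexx ler01.
by rewrite mulr1 mulr0 addr0 Q0 Q1 addrC.
Qed.
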